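(* Let $\lambda$ be a partition, $q\ge1$ an integer, and $T\in\mathrm{Inc}^q(\lambda)$. Then $$K\text{-}\mathrm{Pro}(T)=K\text{-}\mathrm{BK}_{q-1}\circ\cdots\circ K\text{-}\mathrm{BK}_1(T).$$
   Context: **Increasing tableaux.** A partition $\lambda$ is identified with its Young diagram (English convention). An increasing tableau of shape $\lambda$ is a filling of the boxes of $\lambda$ with positive integers that strictly increase from left to right along rows and from top to bottom down columns. $\mathrm{Inc}^q(\lambda)$ is the set of increasing tableaux of shape $\lambda$ with all entries at most $q$ (not every integer in $\{1,\dots,q\}$ need appear). **$K$-promotion.** For $T\in\mathrm{Inc}^q(\lambda)$, delete all labels $1$. Then for $i=2,3,\dots,q$ in turn, consider the set of boxes that are currently empty or contain $i$, and decompose it into connected components (adjacency = sharing an edge; these are short ribbons, i.e. contain no $2\times2$ square and have at most two boxes in each row and column). In each component with more than one box, simultaneously delete every label $i$ and place $i$ in every box that was empty; leave one-box components unchanged. After this, all empty boxes are at outer corners of $\lambda$; fill them with $q+1$ and then subtract $1$ from every entry. The result is $K\text{-}\mathrm{Pro}(T)\in\mathrm{Inc}^q(\lambda)$. **$K$-Bender–Knuth involutions.** For $1\le i\le q-1$ and $T\in\mathrm{Inc}^q(\lambda)$, consider the set of boxes of $T$ containing $i$ or $i+1$ and decompose it into connected components (adjacency = sharing an edge). On each component with more than one box do nothing; on each component that is a single box, replace $i$ by $i+1$, or $i+1$ by $i$. The result is $K\text{-}\mathrm{BK}_i(T)\in\mathrm{Inc}^q(\lambda)$. *)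

(* Defs.v *)
From mathcomp Require Import all_boot.

Set Implicit Arguments.
Unset Strict Implicit.
Unset Printing Implicit Defensive.

Definition is_partition (la : seq nat) : bool := sorted geq la && (0 \notin la).

(* English convention, rows and columns numbered from 0. *)
Definition box (la : seq nat) : finType :=
  {r : 'I_(size la) & 'I_(nth 0 la r)}.

Definition row la (u : box la) : nat := tag u.
Definition col la (u : box la) : nat := tagged u.

Definition adj la (u v : box la) : bool :=
  (row u == row v) && ((col u == (col v).+1) || (col v == (col u).+1))
  || (col u == col v) && ((row u == (row v).+1) || (row v == (row u).+1)).

(* The connected component of u in S, for u in S. *)
Definition component la (S : {set box la}) (u : box la) : {set box la} :=
  [set v | connect [rel x y | [&& x \in S, y \in S & adj x y]] u v].

Definition filling la := {ffun box la -> nat}.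

Definition Inc q la (T : filling la) : bool :=
  [&& [forall u, 0 < T u <= q],
      [forall u, forall v, (row u == row v) && (col u < col v) ==> (T u < T v)]
    & [forall u, forall v, (col u == col v) && (row u < row v) ==> (T u < T v)]].

(* None marks an empty box. *)
Definition partial_filling la := {ffun box la -> option nat}.

Definition delete_ones la (T : filling la) : partial_filling la :=
  [ffun u => if T u == 1 then None else Some (T u)].

Definition promotion_step la (U : partial_filling la) (i : nat) :
    partial_filling la :=
  let S := [set v | (U v == None) || (U v == Some i)] in
  [ffun u => if (u \in S) && (1 < #|component S u|)
             then (if U u == None then Some i else None)
             else U u].

Definition KPro q la (T : filling la) : filling la :=
  let U := foldl (@promotion_step la) (delete_ones T) (index_iota 2 q.+1) in
  [ffun u => (odflt q.+1 (U u)).-1].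

Definition KBK la (i : nat) (T : filling la) : filling la :=
  let S := [set v | (T v == i) || (T v == i.+1)] in
  [ffun u => if (u \in S) && (#|component S u| == 1)
             then (if T u == i then i.+1 else i)
             else T u].

(* Main.v *)
Require Import Defs.
From mathcomp Require Import all_boot.

(** Both sides run through the same intermediate states, written differently.
    After promotion has processed the labels up to [k.+1], read every empty box
    as the label [k.+1], lower by one the labels already processed and keep the
    later ones: this reading, [completion k], is the filling obtained by the
    first [k] Bender-Knuth involutions.  Indeed in this reading the boxes that
    are empty or contain [k.+2] are exactly those labelled [k.+1] or [k.+2], so
    both processes look at the same connected components.  Where promotion
    swaps the empty boxes and the [k.+2]'s, passing from [completion k] to
    [completion k.+1] swaps their two labels back, so that nothing changes;
    where promotion does nothing, that is, on singletons, the change of reading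
    alone swaps [k.+1] and [k.+2].  This is [KBK_completion].  At the end
    [completion q.-1] is the final filling and lowering of labels in promotion,
    because no label exceeds [q]. *)

(** The filling into which promotion would turn [U] if it stopped here, were
    the labels larger than [k.+1] left alone. *)
Definition completion {la} (k : nat) (U : partial_filling la) : filling la :=
  [ffun u => if U u is Some j then (if j <= k.+1 then j.-1 else j) else k.+1].

Lemma completion_delete_ones la (T : filling la) :
  completion 0 (delete_ones T) = T.
Proof.
apply/ffunP => u; rewrite !ffunE.
by case: (T u) => [|[|j]].
Qed.

(** The labels [j <= k.+1] become at most [k], so an empty box is never confused
    with a box that promotion has already processed. *)
Lemma completion_eq la k (U : partial_filling la) u :
  ((completion k U u == k.+1) = (U u == None)) *
  ((completion k U u == k.+2) = (U u == Some k.+2)).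
Proof.
rewrite !ffunE; case: (U u) => [j|]; last by rewrite eqxx ltn_eqF.
rewrite [Some j == Some _]/eq_op /=.
case: leqP => [le_jk | lt_kj]; last by rewrite gtn_eqF.
have lt_jk : j.-1 < k.+1 by case: j le_jk.
by rewrite (ltn_eqF lt_jk) (ltn_eqF (ltnW lt_jk : j.-1 < k.+2)) ltn_eqF.
Qed.

Lemma component_gt0 {la} (S : {set box la}) u : 0 < #|component S u|.
Proof. by apply/card_gt0P; exists u; rewrite inE connect0. Qed.

(** On a component with several boxes the step of promotion and the change of
    reading are two swaps that cancel; on a singleton only the second one
    happens, and it is the Bender-Knuth swap. *)
Lemma KBK_completion la k (U : partial_filling la) :
  KBK k.+1 (completion k U) = completion k.+1 (promotion_step U k.+2).
Proof.
apply/ffunP => u; rewrite [LHS]ffunE [RHS]ffunE [promotion_step _ _ _]ffunE.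
have -> : [set v | (completion k U v == k.+1) || (completion k U v == k.+2)]
        = [set v | (U v == None) || (U v == Some k.+2)].
  by apply/setP => v; rewrite !inE !completion_eq.
set S := [set v | _]; have := component_gt0 S u.
rewrite completion_eq [completion k U u]ffunE inE.
case: #|component S u| => [//|[|n]] _; rewrite ?andbT ?andbF;
  case: (U u) => [j|] //=; rewrite ?leqnn //.
  rewrite [Some j == Some _]/eq_op /=.
  by case: eqP => [->|/eqP ne_j]; rewrite ?leqnn // [in RHS]leq_eqVlt (negPf ne_j).
rewrite [Some j == Some _]/eq_op /=.
case: eqP => [->|/eqP ne_j]; first by rewrite ltnn.
by rewrite [in RHS]leq_eqVlt (negPf ne_j).
Qed.

Lemma foldl_KBK_completion la n k (U : partial_filling la) :
  foldl (fun V i => KBK i V) (completion k U) (iota k.+1 n)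
  = completion (k + n) (foldl (@promotion_step la) U (iota k.+2 n)).
Proof.
elim: n k U => [|n IHn] k U /=; first by rewrite addn0.
by rewrite KBK_completion IHn addSnnS.
Qed.

Lemma foldl_promotion_step_le la q (U : partial_filling la) s :
  all (leq^~ q) s -> (forall u j, U u = Some j -> j <= q) ->
  forall u j, foldl (@promotion_step la) U s u = Some j -> j <= q.
Proof.
elim: s U => [|i s IHs] U //= /andP[le_iq le_sq] le_Uq.
apply: IHs => // u j; rewrite ffunE.
by case: ifP => _; [case: ifP => // _ [<-] | apply: le_Uq].
Qed.

Theorem proposition2p5 (la : seq nat) (q : nat) (T : filling la)
    (hla : is_partition la) (hq : 1 <= q) (hT : Inc q T) :
  KPro q T = foldl (fun U i => KBK i U) T (index_iota 1 q).
Proof.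
have le_Tq u : T u <= q.
  by case/and3P: hT => /forallP/(_ u)/andP[].
rewrite -[T in RHS]completion_delete_ones /index_iota foldl_KBK_completion.
apply/ffunP => u; rewrite [LHS]ffunE [RHS]ffunE /index_iota subSS add0n subn1.
rewrite prednK //; set U := foldl _ _ _; case def_j: (U u) => [j|//].
suff -> : j <= q by [].
apply: foldl_promotion_step_le def_j => [|v i].
  by apply/allP => i; rewrite mem_iota addSn add1n prednK // ltnS => /andP[].
by rewrite ffunE; case: ifP => // _ [<-].
Qed.
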